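(* Let $(X,f)$ be a dynamical system, i.e. $X$ is a nonempty compact metric space and $f\colon X\to X$ is a continuous map (not necessarily surjective). Then there exists an inverse sequence $(\mathcal{G},\mathcal{F})$ of twinned graph homomorphisms such that $(X,f)$ is conjugate to $(Y,T)$, where $Y=V_{\mathcal{G}}/_{E_{\mathcal{F}}}$ (with the quotient topology), $\pi\colon V_{\mathcal{G}}\to Y$ is the projection onto equivalence classes, and $T\colon Y\to Y$ is defined by $\{T(\pi(v))\}=\pi(E_{\mathcal{G}}(v))$ for $v\in V_{\mathcal{G}}$.
   Context: Graphs. A graph is a pair $G=(V,E)$ where $V=\mathrm{V}(G)$ is a finite set (vertices) and $E=\mathrm{E}(G)\subset V\times V$ is a binary relation (edges). It is a non directed graph if $E$ is symmetric. A (non directed) graph homomorphism from $G_1=(V_1,E_1)$ to $G_2=(V_2,E_2)$, both (non directed) graphs, is a map $\phi\colon V_1\to V_2$ such that $(u,v)\in E_1$ implies $(\phi(u),\phi(v))\in E_2$; one writes $\phi\colon G_1\to G_2$. It is edge-surjective if $\{(\phi(u),\phi(v)) : (u,v)\in E_1\}=E_2$. A vertex $v$ has an outgoing edge if $(v,w)\in E$ for some $w\in V$. An inverse sequence of (non directed) graph homomorphisms $(G_i,\phi_i)$ consists of (non directed) graphs $G_i$, $i\ge 0$, and (non directed) graph homomorphisms $\phi_i\colon G_i\to G_{i-1}$, $i\ge 1$. A pair $(\mathcal{G},\mathcal{F})$ is an inverse sequence of twinned graph homomorphisms if: - $|\mathrm{V}(G_0)|=1$; - $\mathcal{G}=(G_i,\phi_i)$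 is an inverse sequence of graph homomorphisms, every vertex of every $G_i$ has an outgoing edge, and $\phi_i\colon G_i\to G_{i-1}$ is edge-surjective for every $i>0$; - $\mathcal{F}=(F_i,\phi_i)$ is an inverse sequence of non directed graph homomorphisms (with the same maps $\phi_i$) such that $\mathrm{V}(G_i)=\mathrm{V}(F_i)$ and $(v,v)\in \mathrm{E}(F_i)$ for every $v\in \mathrm{V}(F_i)$ and $i\ge 0$; - for every $i>0$: if $(a,b)\in \mathrm{E}(F_i)$ and $(a,a'),(b,b')\in \mathrm{E}(G_i)$ for some $a',b'\in \mathrm{V}(G_i)$, then $(\phi_i(a'),\phi_i(b'))\in \mathrm{E}(F_{i-1})$; - for every $i>0$: if $(a,b),(b,c)\in \mathrm{E}(F_i)$, then $(\phi_i(a),\phi_i(c))\in \mathrm{E}(F_{i-1})$. Inverse limits. Put $$V_{\mathcal{G}}=\Big\{(x_i)_{i\ge 0}\in\prod_{i=0}^{\infty}\mathrm{V}(G_i) : x_i=\phi_{i+1}(x_{i+1}) \text{ for all } i\ge 0\Big\},$$ with the topology induced from the product of discrete spaces, and $$E_{\mathcal{G}}=\{(x,y)\in V_{\mathcal{G}}\times V_{\mathcal{G}} : (x_i,y_i)\in \mathrm{E}(G_i)\text{ for all } i\ge 0\},\qquad E_{\mathcal{F}}=\{(x,y)\in V_{\mathcal{G}}\times V_{\mathcal{G}} : (x_i,y_i)\in \mathrm{E}(F_i)\text{ for all } i\ge 0\}.$$ For $v\in V_{\mathcal{G}}$, $E_{\mathcal{G}}(v)=\{w\in V_{\mathcal{G}}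 : (v,w)\in E_{\mathcal{G}}\}$. For every inverse sequence of twinned graph homomorphisms, $E_{\mathcal{F}}$ is an equivalence relation on $V_{\mathcal{G}}$, each set $\pi(E_{\mathcal{G}}(v))$ is a singleton depending only on $\pi(v)$, and the resulting map $T$ is a continuous self-map of the compact metrizable space $Y$; this is a separate result of the same paper, and it is what makes $(Y,T)$ meaningful. Two dynamical systems $(X,f)$ and $(Y,g)$ are conjugate if there is a homeomorphism $\psi\colon Y\to X$ with $f\circ\psi=\psi\circ g$. *)

(* Defs.v *)
From HB Require Import structures.
From mathcomp Require Import all_boot all_order all_algebra.
From mathcomp Require Import all_classical all_reals all_analysis.

Set Implicit Arguments.
Unset Strict Implicit.
Unset Printing Implicit Defensive.

Local Open Scope quotient_scope.
Local Open Scope classical_set_scope.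

Definition graph_hom (U V : finType) (E : rel U) (D : rel V) (h : U -> V) :=
  forall u v, E u v -> D (h u) (h v).

Definition edge_surjective (U V : finType) (E : rel U) (D : rel V)
    (h : U -> V) :=
  [set (h p.1, h p.2) | p in [set p | E p.1 p.2]] = [set q | D q.1 q.2].

(* An inverse sequence (G, F) of twinned graph homomorphisms. Since
   V(G_i) = V(F_i) and the bonding maps coincide, both are stored once:
   [vert i] is the vertex set, [gedge i] = E(G_i), [fedge i] = E(F_i), and
   [bond i] is phi_{i+1} : vert i.+1 -> vert i. *)
Record twinned_seq := TwinnedSeq {
  vert : nat -> finType ;
  gedge : forall i, rel (vert i) ;
  fedge : forall i, rel (vert i) ;
  bond : forall i, vert i.+1 -> vert i ;
  card_vert0 : #|vert 0| = 1 ;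
  gedge_out : forall i (v : vert i), exists w, gedge v w ;
  gedge_hom : forall i, graph_hom (@gedge i.+1) (@gedge i) (@bond i) ;
  gedge_surj : forall i, edge_surjective (@gedge i.+1) (@gedge i) (@bond i) ;
  fedge_sym : forall i, symmetric (@fedge i) ;
  fedge_refl : forall i, reflexive (@fedge i) ;
  fedge_hom : forall i, graph_hom (@fedge i.+1) (@fedge i) (@bond i) ;
  fedge_gedge : forall i (a b a' b' : vert i.+1),
    fedge a b -> gedge a a' -> gedge b b' -> fedge (bond a') (bond b') ;
  fedge_bond_trans : forall i (a b c : vert i.+1),
    fedge a b -> fedge b c -> fedge (bond a) (bond c)
}.

Section InverseLimit.
Variable S : twinned_seq.

Definition inv_lim_set :
    set (prod_topology (fun i => discrete_topology (vert S i))) :=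
  [set x : forall i, vert S i | forall i, x i = bond (x i.+1)].

(* V_G, with the topology induced from the product of discrete spaces *)
Definition inv_lim : topologicalType := inv_lim_set.

Definition lim_gedge (x y : inv_lim) : Prop :=
  forall i, gedge (\val x i : vert S i) (\val y i).

Definition lim_fedge (x y : inv_lim) : Prop :=
  forall i, fedge (\val x i : vert S i) (\val y i).

Definition lim_fedgeb (x y : inv_lim) : bool := `[< lim_fedge x y >].

Lemma lim_fedgeb_refl : reflexive lim_fedgeb.
Proof. by move=> x; apply/asboolP => i; exact: fedge_refl. Qed.

Lemma lim_fedgeb_sym : symmetric lim_fedgeb.
Proof.
by move=> x y; apply/asboolP/asboolP => xy i; rewrite fedge_sym; exact: xy.
Qed.

Lemma lim_fedgeb_trans : transitive lim_fedgeb.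
Proof.
move=> y x z /asboolP xy /asboolP yz; apply/asboolP => i.
have xE : \val x i = bond (\val x i.+1 : vert S i.+1).
  by have /set_mem := valP x; exact.
have zE : \val z i = bond (\val z i.+1 : vert S i.+1).
  by have /set_mem := valP z; exact.
by rewrite xE zE; exact: fedge_bond_trans (xy i.+1) (yz i.+1).
Qed.

Canonical lim_fedge_equiv :=
  EquivRel lim_fedgeb lim_fedgeb_refl lim_fedgeb_sym lim_fedgeb_trans.

(* Y = V_G / E_F, with the quotient topology *)
Definition lim_quot : topologicalType :=
  quotient_topology {eq_quot lim_fedge_equiv}.

Definition lim_proj (v : inv_lim) : lim_quot :=
  \pi_{eq_quot lim_fedge_equiv} v.

(* {T (pi v)} = pi (E_G(v)) for every v; as pi is onto, at most one T
   satisfies this *)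
Definition is_lim_map (T : lim_quot -> lim_quot) :=
  forall v, [set T (lim_proj v)] = lim_proj @` [set w | lim_gedge v w].

End InverseLimit.

Definition homeomorphism (A B : topologicalType) (h : A -> B) :=
  continuous h /\
  exists k : B -> A, [/\ cancel h k, cancel k h & continuous k].

Definition conjugate_systems (X Y : topologicalType)
    (f : X -> X) (g : Y -> Y) :=
  exists2 psi : Y -> X, homeomorphism psi & f \o psi = psi \o g.

(* Main.v *)
(* Cut X into finitely many cells, ever more finely, the cells of level i + 1
   (of mesh e (i + 1)) refining those of level i. Put a G-edge from a to b when
   f maps some point of a into b, and an F-edge between a and b when they
   contain points at distance less than e i. If 3 e (i + 1) <= e i and points
   at distance less than 3 e (i + 1) have images at distance less than e i,
   these graphs are twinned. A nested sequence of cells accumulates at a single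
   point of X, two sequences accumulate at the same point exactly when they are
   F-related, and G-related sequences accumulate at points x and f x. The
   induced bijection from the compact quotient onto X is continuous, hence a
   homeomorphism. *)
From HB Require Import structures.
Require Import Defs.
From mathcomp Require Import all_boot all_order all_algebra.
From mathcomp Require Import all_classical all_reals all_analysis.
From mathcomp Require Import finmap lra.

Set Implicit Arguments.
Unset Strict Implicit.
Unset Printing Implicit Defensive.

Import Order.TTheory GRing.Theory Num.Theory.

Local Open Scope classical_set_scope.

(** * Compactness, homeomorphisms and coordinates in products *)

Lemma compact_set_type (T : topologicalType) (A : set T) :
  compact A -> compact [set: A].
Proof.
move=> cA F PF _.
have [x [Ax xF]] : A `&` cluster (\val @ F) !=set0.
  apply: cA; rewrite nbhs_simpl /=.
  by apply: filterS filterT => a _; exact: set_valP.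
exists (SigSub (mem_set Ax)); split => // C D FC [_ [[W oW <-] Wx] sWD].
have [z [[a Ca az] Wz]] : (\val @` C) `&` W !=set0.
  apply: xF; last exact: open_nbhs_nbhs.
  by rewrite nbhs_simpl /=; apply: (filterS _ FC) => a Ca; exists a.
by exists a; split => //; apply: sWD; rewrite /= set_valE az.
Qed.

(** Closed subsets of [A] are compact, so their images are compact, hence closed in the Hausdorff
    space [B]. *)
Lemma continuous_bij_homeomorphism (A B : topologicalType) (h : A -> B)
    (k : B -> A) :
  compact [set: A] -> hausdorff_space B -> continuous h ->
  cancel h k -> cancel k h -> homeomorphism h.
Proof.
move=> cA hB ch hK kK; split => //; exists k; split => //.
apply/continuous_closedP => C cC.
have -> : k @^-1` C = h @` C.
  by apply/seteqP; split => [b Cb|_ [a Ca <-]]; [exists (k b)|rewrite /= hK].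
apply: compact_closed => //; apply: continuous_compact.
  exact: continuous_subspaceT.
exact: subclosed_compact cC cA _.
Qed.

Lemma near_coord (I : eqType) (T : I -> choiceType)
    (x : prod_topology (fun i => discrete_topology (T i))) i :
  \forall y \near x, y i = x i.
Proof.
exact: (@proj_continuous I (fun i => discrete_topology (T i)) i x [set x i]
  (@discrete_set1 (discrete_topology (T i)) (x i))).
Qed.

(** * Compactness of the inverse limit and of its quotient *)

Section InvLim.
Variable S : twinned_seq.

Lemma near_inv_lim (v : inv_lim S) i :
  \forall w \near v, \val w i = \val v i.
Proof.
exact: (@initial_continuous _ _ (@set_val _ (@inv_lim_set S)) v _
  (near_coord (\val v) i)).
Qed.

Lemma bond_val (v : inv_lim S) i : bond (\val v i.+1) = \val v i.
Proof. by rewrite -(set_mem (valP v) i). Qed.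

Lemma inv_lim_compact : compact [set: inv_lim S].
Proof.
apply: compact_set_type.
have cT : compact
    [set: prod_topology (fun i => discrete_topology (vert S i))].
  have := @tychonoff _ (fun i => discrete_topology (vert S i)) (fun=> setT).
  have -> : [set x | forall i, [set: discrete_topology (vert S i)] (x i)] =
    setT by apply/seteqP; split.
  apply=> i; apply: finite_compact; exact: (@finite_finset (vert S i)).
(* Each defining equation involves two coordinates only, so it passes to points of the closure. *)
apply: subclosed_compact cT _ => // x clx i.
have [y [Sy [yi ySi]]] : @inv_lim_set S `&`
    [set y | y i = x i /\ y i.+1 = x i.+1] !=set0.
  by apply: clx; apply: filterI; exact: near_coord.
by rewrite -yi -ySi.
Qed.

Lemma lim_projP (v w : inv_lim S) : lim_proj v = lim_proj w <-> lim_fedge v w.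
Proof.
have eP := @eqmodP _ (lim_fedge_equiv S) v w.
by split=> [/eP/asboolP|vw]; [|apply/eP/asboolP].
Qed.

Lemma lim_quot_compact : compact [set: lim_quot S].
Proof.
have -> : [set: lim_quot S] = @lim_proj S @` setT.
  by apply/esym/seteqP; split => // y _; exists (repr y) => //; exact: reprK.
apply: continuous_compact inv_lim_compact.
apply: continuous_subspaceT; exact: pi_continuous.
Qed.

End InvLim.

(** * Coding points of [X] by nested sequences of cells *)

Section Coding.
Local Open Scope ring_scope.
Context (R : realType) (X : metricType R) (f : X -> X) (eps : nat -> R).
Context (P : nat -> finType) (lab : forall i, X -> P i).
Context (q : forall i, P i.+1 -> P i).
Hypothesis compX : compact [set: X].
Hypothesis cardP0 : #|P 0%N| = 1%N.
Hypothesis lab_surj : forall i a, exists x, lab i x = a.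
Hypothesis q_lab : forall i x, q (lab i.+1 x) = lab i x.
(** Level 0 is exempt: its only cell is all of [X], whose diameter is arbitrary. *)
Hypothesis lab_small :
  forall i x y, lab i.+1 x = lab i.+1 y -> mdist x y < eps i.+1.
Hypothesis eps_gt0 : forall i, 0 < eps i.
Hypothesis eps3 : forall i, 3 * eps i.+1 <= eps i.
Hypothesis eps_f :
  forall i x y, mdist x y < 3 * eps i.+1 -> mdist (f x) (f y) < eps i.

Definition cell_gedge i (a b : P i) : bool :=
  `[< exists2 x, lab i x = a & lab i (f x) = b >].

Definition cell_fedge i (a b : P i) : bool :=
  `[< exists x y, [/\ lab i x = a, lab i y = b & mdist x y < eps i] >].

Lemma lab_q i x a : lab i.+1 x = a -> lab i x = q a.
Proof. by move=> <-; rewrite q_lab. Qed.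

Lemma cell_gedge_out i (a : P i) : exists b, cell_gedge a b.
Proof.
by have [x xa] := lab_surj a; exists (lab i (f x)); apply/asboolP; exists x.
Qed.

Lemma cell_gedge_hom i :
  graph_hom (@cell_gedge i.+1) (@cell_gedge i) (@q i).
Proof.
by move=> a b /asboolP[x /lab_q xa /lab_q xb]; apply/asboolP; exists x.
Qed.

Lemma cell_gedge_surj i :
  edge_surjective (@cell_gedge i.+1) (@cell_gedge i) (@q i).
Proof.
apply/seteqP; split => [_ [p pE <-]|[a b] /= /asboolP[x <- <-]].
  exact: cell_gedge_hom.
exists (lab i.+1 x, lab i.+1 (f x)); last by rewrite /= !q_lab.
by apply/asboolP; exists x.
Qed.

Lemma cell_fedge_sym i : symmetric (@cell_fedge i).
Proof.
by move=> a b; apply/asboolP/asboolP => -[x [y [xa yb xy]]];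
  exists y, x; rewrite metric_sym.
Qed.

Lemma cell_fedge_refl i : reflexive (@cell_fedge i).
Proof.
move=> a; have [x xa] := lab_surj a.
by apply/asboolP; exists x, x; rewrite mdistxx.
Qed.

Lemma cell_fedge_hom i :
  graph_hom (@cell_fedge i.+1) (@cell_fedge i) (@q i).
Proof.
move=> a b /asboolP[x [y [/lab_q xa /lab_q yb xy]]].
apply/asboolP; exists x, y; split => //.
by have := eps3 i; have := eps_gt0 i.+1; lra.
Qed.

(** The chain [x'], [x], [y], [y'] has three steps shorter than [eps i.+1]; this is the factor 3 in
    [eps_f]. *)
Lemma cell_fedge_gedge i (a b a' b' : P i.+1) :
  cell_fedge a b -> cell_gedge a a' -> cell_gedge b b' ->
  cell_fedge (q a') (q b').
Proof.
move=> /asboolP[x [y [xa yb xy]]] /asboolP[x' x'a /lab_q xa'].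
move=> /asboolP[y' y'b /lab_q yb'].
apply/asboolP; exists (f x'), (f y'); split => //; apply: eps_f.
have x'x : mdist x' x < eps i.+1 by apply: lab_small; rewrite x'a.
have yy' : mdist y y' < eps i.+1 by apply: lab_small; rewrite y'b.
by have := metric_triangle x' x y'; have := metric_triangle x y y'; lra.
Qed.

Lemma cell_fedge_trans i (a b c : P i.+1) :
  cell_fedge a b -> cell_fedge b c -> cell_fedge (q a) (q c).
Proof.
move=> /asboolP[x [y [/lab_q xa yb xy]]].
move=> /asboolP[y' [z [y'b /lab_q zc y'z]]].
apply/asboolP; exists x, z; split => //.
have yy' : mdist y y' < eps i.+1 by apply: lab_small; rewrite y'b.
have := metric_triangle x y z; have := metric_triangle y y' z.
by have := eps3 i; lra.
Qed.

Definition cell_seq : twinned_seq :=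
  TwinnedSeq cardP0 cell_gedge_out cell_gedge_hom cell_gedge_surj
    cell_fedge_sym cell_fedge_refl cell_fedge_hom cell_fedge_gedge
    cell_fedge_trans.

Local Notation V := (inv_lim cell_seq).
Local Notation Y := (lim_quot cell_seq).
Local Notation coord v i := (\val (v : V) i : P i).

Lemma q_coord (v : V) i : q (coord v i.+1) = coord v i.
Proof. exact: (bond_val v i). Qed.

Lemma lab_coord_le (v : V) i n x : (i <= n)%N ->
  lab n x = coord v n -> lab i x = coord v i.
Proof.
move=> /subnK <-; elim: (n - i)%N => // k IH /lab_q xk.
by apply: IH; rewrite xk q_coord.
Qed.

Lemma address_subproof x : @inv_lim_set cell_seq (fun i => lab i x).
Proof. by move=> i /=; rewrite q_lab. Qed.

Definition address (x : X) : V := SigSub (mem_set (address_subproof x)).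

Lemma eps_cvg0 (e : R) : 0 < e -> exists i, eps i.+1 < e.
Proof.
move=> e0.
(* A crude linear bound is enough; it is inductive because i + 2 <= 3 (i + 1). *)
have eps_le i : i.+1%:R * eps i <= eps 0%N.
  elim: i => [|i IH]; first by rewrite mul1r.
  apply: le_trans IH; have := eps3 i; have := eps_gt0 i.+1.
  rewrite -!natr1; have : 0 <= i%:R :> R by []. nra.
exists (Num.truncn (eps 0%N / e)); set i := Num.truncn _.
have : eps 0%N / e < i.+1%:R by exact: truncnS_gt.
rewrite ltr_pdivrMr// => e0i; rewrite -(ltr_pM2l (ltr0Sn R i)).
apply: le_lt_trans e0i; apply: le_trans (eps_le i.+1).
by rewrite ler_pM2r// ler_nat.
Qed.

(* Cells need not be closed, so a sequence of cells may have empty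
   intersection: the point coded is only required to be close to each cell. *)
Definition codes (v : V) (p : X) :=
  forall i, exists2 x, lab i x = coord v i & mdist x p < eps i.

(** Take a cluster point of points chosen in the successive cells; those chosen at levels n >= i all
    lie in the i-th cell. *)
Lemma codes_ex v : exists p, codes v p.
Proof.
have /choice[x xv] n : exists x, lab n x = coord v n by exact: lab_surj.
have [p [_ px]] : [set: X] `&` cluster (x @ \oo) !=set0.
  by apply: compX; exact: filterT.
exists p => i.
have [_ [[n /= in_ <-] pxn]] :
    (x @` [set n | (i <= n)%N]) `&` ball p (eps i) !=set0.
  apply: px; last exact: nbhsx_ballx.
  by exists i => // n /= in_; exists n.
exists (x n); first exact: lab_coord_le (xv n).
by rewrite metric_sym; move: pxn; rewrite ballEmdist.
Qed.

Lemma address_codes x : codes (address x) x.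
Proof. by move=> i; exists x; rewrite ?mdistxx. Qed.

(** Any fixed multiple of [eps i.+1] would do; 7 leaves room for the sums of five and of three steps
    met below. *)
Lemma mdist_small_eq (x y : X) :
  (forall i, mdist x y < 7 * eps i.+1) -> x = y.
Proof.
move=> xy; apply: mdist_positivity; apply/eqP; rewrite eq_le mdist_ge0 andbT.
rewrite leNgt; apply/negP => xy0.
have [|i ie] := @eps_cvg0 (mdist x y / 7); first by lra.
by have := xy i; lra.
Qed.

(** The chain [p], [x], [x'], [y'], [y], [r] has five steps shorter than [eps i.+1]. *)
Lemma codes_mdist v w p r i : codes v p -> codes w r ->
  cell_fedge (coord v i.+1) (coord w i.+1) -> mdist p r < 5 * eps i.+1.
Proof.
move=> /(_ i.+1)[x xv xp] /(_ i.+1)[y yw yr] /asboolP[x' [y' [x'v y'w x'y']]].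
have xx' : mdist x x' < eps i.+1 by apply: lab_small; rewrite xv.
have y'y : mdist y' y < eps i.+1 by apply: lab_small; rewrite yw.
have := metric_triangle p x r; have := metric_triangle x x' r.
have := metric_triangle x' y' r; have := metric_triangle y' y r.
rewrite (metric_sym p x); lra.
Qed.

Lemma codes_fedge v w p r : codes v p -> codes w r ->
  lim_fedge v w <-> p = r.
Proof.
move=> vp wr; split => [vw|pr].
  apply: mdist_small_eq => i; have := codes_mdist vp wr (vw i.+1).
  by have := eps_gt0 i.+1; lra.
rewrite -pr in wr.
(* Witnesses from level i + 1 are within 2 [eps i.+1] < [eps i] of each other; those of level i
   would only give 2 [eps i]. *)
move=> i; have [x xv xp] := vp i.+1; have [y yw yp] := wr i.+1.
apply/asboolP; exists x, y; split.
- by rewrite (lab_q xv) q_coord.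
- by rewrite (lab_q yw) q_coord.
have := metric_triangle x p y; rewrite (metric_sym p y).
by have := eps3 i; have := eps_gt0 i.+1; lra.
Qed.

Lemma codes_gedge v w p : codes v p -> lim_gedge v w -> codes w (f p).
Proof.
move=> vp vw; have [r wr] := codes_ex w.
suff -> : f p = r by [].
(* Applying [f] costs one level, so start at level i + 2 to get bounds by [eps i.+1]. *)
apply: mdist_small_eq => i; have [x xv xp] := vp i.+2.
have [y yw yr] := wr i.+1.
have /asboolP[x' x'v x'w] := vw i.+2.
have x'x : mdist x' x < eps i.+2 by apply: lab_small; rewrite xv.
have fx'p : mdist (f x') (f p) < eps i.+1.
  apply: eps_f; have := metric_triangle x' x p; have := eps_gt0 i.+2; lra.
have fx'y : mdist (f x') y < eps i.+1.
  by apply: lab_small; rewrite yw (lab_q x'w) q_coord.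
have := metric_triangle (f p) (f x') r; have := metric_triangle (f x') y r.
by rewrite (metric_sym (f p) (f x')); have := eps_gt0 i.+1; lra.
Qed.

(** The point coded by [v] may lie outside the cells of [v], so the address of its image need not be
    a successor. Instead, take a cluster point of the addresses of images of points that do lie in
    these cells. *)
Lemma lim_gedge_ex (v : V) : exists w, lim_gedge v w.
Proof.
have /choice[x xv] n : exists x, lab n x = coord v n by exact: lab_surj.
have [w [_ wx]] :
    [set: V] `&` cluster ((fun n => address (f (x n))) @ \oo) !=set0.
  by apply: inv_lim_compact; exact: filterT.
exists w => i.
have [_ [[n /= in_ <-] wn]] :
    ((fun n => address (f (x n))) @` [set n | (i <= n)%N]) `&`
    [set u | \val u i = \val w i] !=set0.
  apply: wx; last exact: near_inv_lim.
  by exists i => // n /= in_; exists n.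
apply/asboolP; exists (x n); first exact: lab_coord_le (xv n).
by rewrite -wn.
Qed.

Definition decode (v : V) : X := projT1 (cid (codes_ex v)).

Lemma decodeP v : codes v (decode v).
Proof. exact: projT2 (cid (codes_ex v)). Qed.

(** Sequences sharing coordinate i + 1 are F-related there, so they decode to points within 5
    [eps i.+1]. *)
Lemma decode_continuous : continuous decode.
Proof.
move=> v; apply/(@cvg_ballP _ _ _ (nbhs v) (nbhs_filter v)) => e e0.
have [|i ie] := @eps_cvg0 (e / 5); first by lra.
apply: (@filterS _ (nbhs v) (nbhs_filter v) _ _ _ (near_inv_lim v i.+1)).
move=> w wv.
rewrite ballEmdist /=; apply: lt_trans (_ : 5 * eps i.+1 < _); last by lra.
apply: codes_mdist (decodeP v) (decodeP w) _.
by rewrite wv; exact: cell_fedge_refl.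
Qed.

Definition decode_quot (y : Y) : X := decode (repr y).

Lemma decode_quot_proj v : decode_quot (lim_proj v) = decode v.
Proof.
apply/(codes_fedge (decodeP _) (decodeP _))/lim_projP.
exact: reprK.
Qed.

Lemma decode_address x : decode (address x) = x.
Proof.
apply/(codes_fedge (decodeP _) (address_codes _)) => i.
exact: cell_fedge_refl.
Qed.

Lemma decode_quotK : cancel decode_quot (fun x => lim_proj (address x)).
Proof.
move=> y; rewrite -[RHS](@reprK _ _ y); apply/lim_projP.
exact/(codes_fedge (address_codes _) (decodeP _)).
Qed.

Lemma decode_quot_continuous : continuous decode_quot.
Proof.
apply/quotient_continuous.
rewrite (_ : _ \o _ = decode); first exact: decode_continuous.
by apply/funext => v; exact: decode_quot_proj.
Qed.

Lemma decode_quot_homeomorphism : homeomorphism decode_quot.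
Proof.
apply: (@continuous_bij_homeomorphism _ _ _ (fun x => lim_proj (address x))).
- exact: lim_quot_compact.
- exact: metric_hausdorff.
- exact: decode_quot_continuous.
- exact: decode_quotK.
- by move=> x; rewrite decode_quot_proj decode_address.
Qed.

Lemma cell_seq_conjugate :
  exists T : Y -> Y, is_lim_map T /\ conjugate_systems f T.
Proof.
(* Transport [f] to the quotient. All G-successors of [v] code [f (decode v)], so they form a single
   class. *)
exists (fun y => lim_proj (address (f (decode_quot y)))); split.
  move=> v; rewrite decode_quot_proj.
  have vP w : lim_gedge v w ->
      lim_proj w = lim_proj (address (f (decode v))).
    move=> /(codes_gedge (decodeP v)) wP; apply/lim_projP.
    exact/(codes_fedge wP (address_codes _)).
  apply/seteqP; split => [_ ->|_ [w vw <-]]; last exact: vP.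
  by have [w vw] := lim_gedge_ex v; exists w => //; exact: vP.
exists decode_quot; first exact: decode_quot_homeomorphism.
by apply/funext => y /=; rewrite decode_quot_proj decode_address.
Qed.

End Coding.

(** * Refining finite partitions and moduli of continuity *)

Section Partitions.
Local Open Scope ring_scope.
Context (R : realType) (X : metricType R).
Hypothesis compX : compact [set: X].

Lemma compact_finite_mesh (x0 : X) (e : R) : 0 < e ->
  exists (I : finType) (c : X -> I), forall x y, c x = c y -> mdist x y < e.
Proof.
move=> e0; pose pX := isPointed.Build X x0.
pose Xp := HB.pack_for ptopologicalType X pX.
have e20 : 0 < e / 2 by lra.
have cX : @cover_compact Xp setT by rewrite -compact_cover.
have [||D _ DX] := cX X setT (fun a => interior (ball a (e / 2))).
- by move=> a _; exact: open_interior.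
- by move=> x _; exists x => //; exact: nbhsx_ballx.
(* Colour each point by the centre of a ball of the finite cover that contains it. *)
have /choice[c cP] x : exists a : D, mdist (val a) x < e / 2.
  have [a /= aD ax] := DX x I; exists [` aD]%fset.
  by have := interior_subset ax; rewrite ballEmdist.
exists D, c => x y cxy; have := metric_triangle x (val (c x)) y.
by have := cP x; have := cP y; rewrite -cxy (metric_sym x (val (c x))); lra.
Qed.

Lemma compact_unif_continuous (f : X -> X) (e : R) : continuous f -> 0 < e ->
  exists d, [/\ 0 < d, d <= e &
    forall x y, mdist x y < d -> mdist (f x) (f y) < e].
Proof.
move=> cf e0.
have unif : \forall d \near 0^'+,
    [set: X] `<=` (fun x => forall y, mdist x y < d -> mdist (f x) (f y) < e).
  apply: (compact_near_coveringP _).1 => // x _.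
  have e20 : 0 < e / 2 by lra.
  have /nbhs_ballP[r /= r0 rf] := cf x _ (nbhsx_ballx (f x) _ e20).
  have {}rf y : mdist x y < r -> mdist (f x) (f y) < e / 2.
    by move=> xy; have := rf y; rewrite !ballEmdist; apply.
  have r20 : 0 < r / 2 by lra.
  (* With both radii halved, [x'] and every [y] within [d] of it stay within [r] of [x]. *)
  exists (ball x (r / 2), [set d | d < r / 2]).
    by split; [exact: nbhsx_ballx|exact: nbhs_right_lt].
  move=> [x' d] /= [+ dr] y x'y; rewrite ballEmdist /= => xx'.
  have := metric_triangle x x' y; have := metric_triangle (f x') (f x) (f y).
  have := rf x'; have := rf y; rewrite (metric_sym (f x') (f x)); lra.
have [d [df d0 de]] : exists d : R,
    [/\ [set: X] `<=` (fun x => forall y, mdist x y < d ->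
      mdist (f x) (f y) < e), 0 < d & d <= e].
  near (0 : R)^'+ => d; exists d; split; near: d.
  - exact: unif.
  - exact: nbhs_right_gt.
  - exact: nbhs_right_ltW.
by exists d; split => // x; exact: df.
Unshelve. all: by end_near. Qed.

(* [refined_cell i] still contains empty cells; [cell i] keeps the others. *)
Fixpoint refined_cell (I : nat -> finType) i : finType :=
  if i is j.+1 then (refined_cell I j * I j)%type else unit.

(** Keeping all earlier colours makes the partitions nested: forgetting the last colour is the
    bonding map. *)
Fixpoint itinerary (I : nat -> finType) (c : forall i, X -> I i) i :
    X -> refined_cell I i :=
  if i is j.+1 then fun x => (itinerary c j x, c j x) else fun=> tt.

Definition cell (I : nat -> finType) (c : forall i, X -> I i) i : finType :=
  {a : refined_cell I i | `[< exists x, itinerary c i x = a >]}.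

Lemma refining_partitions (x0 : X) (e : nat -> R) : (forall i, 0 < e i) ->
  exists (P : nat -> finType) (lab : forall i, X -> P i)
      (q : forall i, P i.+1 -> P i),
    [/\ #|P 0%N| = 1%N, forall i a, exists x, lab i x = a,
      forall i x, q i (lab i.+1 x) = lab i x &
      forall i x y, lab i.+1 x = lab i.+1 y -> mdist x y < e i].
Proof.
move=> e0.
have /choice[Ic cP] i : exists Ic : {I : finType & X -> I},
    forall x y, tagged Ic x = tagged Ic y -> mdist x y < e i.
  by have [I [c cP]] := compact_finite_mesh x0 (e0 i); exists (Tagged _ c).
pose I i := tag (Ic i); pose c i : X -> I i := tagged (Ic i).
have labP i x : `[< exists y, itinerary c i y = itinerary c i x >].
  by apply/asboolP; exists x.
pose lab i x : cell c i := exist _ (itinerary c i x) (labP i x).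
have qP i (a : cell c i.+1) : `[< exists y, itinerary c i y = (val a).1 >].
  by case: a => a /= /asboolP[x <-]; apply/asboolP; exists x.
pose q i (a : cell c i.+1) : cell c i := exist _ (val a).1 (qP i a).
have lab_surj i a : exists x, lab i x = a.
  by case: a => a aP; have /asboolP[x xa] := aP; exists x; exact: val_inj.
exists (cell c), lab, q; split => //.
- apply/eqP/fintype1P; exists (lab 0%N x0) => a.
  by apply: val_inj; case: (val a).
- by move=> i x; exact: val_inj.
- by move=> i x y /(congr1 val) /= [_ /cP].
Qed.

Lemma modulus_sequence (f : X -> X) : continuous f ->
  exists e : nat -> R, [/\ forall i, 0 < e i,
    forall i, 3 * e i.+1 <= e i &
    forall i x y, mdist x y < 3 * e i.+1 -> mdist (f x) (f y) < e i].
Proof.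
move=> cf.
(* Choice ranges over all reals, hence the guard [0 < e] and the dummy value 0 elsewhere. *)
have /choice[d dP] (e : R) : exists d : R, 0 < e ->
    [/\ 0 < d, d <= e &
      forall x y, mdist x y < d -> mdist (f x) (f y) < e].
  have [e0|] := ltP 0 e; last by exists 0.
  by have [d ?] := compact_unif_continuous cf e0; exists d.
(* Dividing by 3 makes [3 * e i.+1] equal to [d (e i)], so both inequalities are those satisfied by
   [d]. *)
pose e i := iter i (fun r => d r / 3) 1.
have e0 i : 0 < e i.
  by elim: i => //= i /dP[d0 _ _]; rewrite divr_gt0.
have eS i : 3 * e i.+1 = d (e i) by rewrite /= mulrC divfK.
by exists e; split => // i; rewrite eS; have [] := dP _ (e0 i).
Qed.

End Partitions.

Theorem theorem3p4 (R : realType) (X : metricType R) (f : X -> X)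
    (X_nonempty : [set: X] !=set0) (X_compact : compact [set: X])
    (f_continuous : continuous f) :
  exists (S : twinned_seq) (T : lim_quot S -> lim_quot S),
    is_lim_map T /\ conjugate_systems f T.
Proof.
have [x0 _] := X_nonempty.
have [e [e_gt0 e3 e_f]] := modulus_sequence X_compact f_continuous.
(* The cells of level i + 1 get the i-th prescribed mesh, hence the shifted sequence. *)
have [P [lab [q [cardP0 lab_surj q_lab lab_small]]]] :=
  refining_partitions X_compact x0 (fun i => e_gt0 i.+1).
eexists; exact: (cell_seq_conjugate X_compact cardP0 lab_surj q_lab lab_small
  e_gt0 e3 e_f).
Qed.
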